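(* Let $A$ be a nonempty set, $G$ a group, $F:A\to\mathcal P(G)$ a soft group and $\tau$ a soft topology on $F$ such that $(F,\tau)$ is a soft paratopological group. Then the join topology $\tau^\ast\vee(\tau^{-1})^\ast$ on $\mathrm{SE}(F)=\prod_{t\in A}F(t)$ is the box topology generated by the component joins $\tau_t\vee\tau_t^{-1}$, $t\in A$. If $A$ is finite and each coordinate join $(F(t),\tau_t\vee\tau_t^{-1})$ is $\omega$-bounded, then $(\mathrm{SE}(F),\tau^\ast\vee(\tau^{-1})^\ast)$ is $\omega$-bounded. For infinite $A$, coordinatewise compactness or coordinatewise $\omega$-boundedness need not imply the corresponding property for the box join: for every infinite set $A$ there is a soft paratopological group $(F,\tau)$ with parameter set $A$ such that every $(F(t),\tau_t\vee\tau_t^{-1})$ is compact but $(\mathrm{SE}(F),\tau^\ast\vee(\tau^{-1})^\ast)$ is not compact, and there is a soft paratopological group $(F,\tau)$ with parameter set $A$ such that every $(F(t),\tau_t\vee\tau_t^{-1})$ is $\omega$-bounded but $(\mathrm{SE}(F),\tau^\ast\vee(\tau^{-1})^\ast)$ is not $\omega$-bounded.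
   Context: A soft set over $G$ with parameter set $A$ is a map $F:A\to\mathcal P(G)$; it is a soft group if every $F(t)$ is a subgroup of $G$. $\mathrm{SE}(F)=\prod_{t\in A}F(t)$ is a group under pointwise multiplication $\ast$ and inversion. A soft subset of $F$ is a map $H:A\to\mathcal P(G)$ with $H(t)\subseteq F(t)$ for all $t$; soft unions and intersections are parameterwise. A soft topology $\tau$ on $F$ is a family of soft subsets of $F$ containing $F$ and the empty soft set (all sections empty), closed under arbitrary soft unions and finite soft intersections. Component topology: $\tau_t=\{H(t):H\in\tau\}$ on $F(t)$. The selector (box) topology $\tau^\ast$ on $\mathrm{SE}(F)$ has base $\{\prod_{t\in A}U_t:U_t\in\tau_t\ \forall t\}$. $(F,\tau)$ is a soft paratopological group if $(a,b)\mapsto a\ast b$ is continuous from $\tau^\ast\times\tau^\ast$ to $\tau^\ast$. Write $\tau_t^{-1}=\{U^{-1}:U\in\tau_t\}$ with $U^{-1}=\{x^{-1}:x\in U\}$. The conjugate soft topology $\tau^{-1}$ consists of all soft subsets $H$ of $F$ with $H(t)\in\tau_t^{-1}$ for all $t$; its selector topology $(\tau^{-1})^\ast$ has base $\{\prod_t V_t: V_t\in\tau_t^{-1}\ \forall t\}$. For topologies $\alpha,\beta$ on a set, $\alpha\vee\beta$ is the topology generated by $\alpha\cup\beta$. A space is $\omega$-bounded if every countable subset has compact closure (no separation axiom is assumed in ''compact''). *)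

(* Defs.v *)
From HB Require Import structures.
From mathcomp Require Import all_boot.
From mathcomp Require Import boolp classical_sets functions cardinality topology.
Set Implicit Arguments.
Unset Strict Implicit.
Unset Printing Implicit Defensive.

Local Open Scope classical_set_scope.
Local Open Scope group_scope.

(* Several topologies on the same set have to be compared, and the sets are
   subsets of an ambient type, so topologies are families of subsets of X.
   The empty set is open as the union of the empty subfamily. *)
Record is_topology (T : Type) (X : set T) (O : set (set T)) : Prop := {
  top_sub : forall U, O U -> U `<=` X;
  top_full : O X;
  top_bigcup : forall D : set (set T), D `<=` O -> O (\bigcup_(U in D) U);
  topI : forall U V, O U -> O V -> O (U `&` V) }.

Record topology (T : Type) (X : set T) := Topology {
  opens : set (set T);
  opensP : is_topology X opens }.

(* The topological space (X, O), carried by the subtype of elements of X; its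
   open sets are the members of O seen as sets of elements of the subtype. *)
Definition space (T : Type) (X : set T) (O : topology X) : Type := set_type X.

Section Space.
Context (T : Type) (X : set T) (O : topology X).

Definition space_open : set (set (space O)) :=
  [set (fun x : space O => U (\val x)) | U in opens O].

Lemma space_openT : space_open setT.
Proof.
exists X; first exact: top_full (opensP O).
by apply/seteqP; split => // -[x /= /set_mem].
Qed.

Lemma space_openI : setI_closed space_open.
Proof.
by move=> _ _ [U OU <-] [V OV <-]; exists (U `&` V) => //; exact: topI (opensP O) _ _ OU OV.
Qed.

Lemma space_open_bigcup (I : Type) (f : I -> set (space O)) :
  (forall i, space_open (f i)) -> space_open (\bigcup_i f i).
Proof.
move=> Of; pose D := [set U | opens O U /\ exists i, f i = (fun x : space O => U (\val x))].
exists (\bigcup_(U in D) U); first by apply: top_bigcup (opensP O) _ _ => U [].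
apply/seteqP; split => x.
  by move=> [U [_ [i fi]] Ux]; exists i => //; rewrite fi.
by move=> [i _ fix_]; have [U OU fU] := Of i; exists U; [split => //; exists i | rewrite -fU in fix_].
Qed.

HB.instance Definition _ := gen_eqMixin (space O).
HB.instance Definition _ := gen_choiceMixin (space O).
HB.instance Definition _ := isOpenTopological.Build (space O)
  space_openT space_openI space_open_bigcup.

End Space.

Definition compact_top (T : Type) (X : set T) (O : topology X) : Prop :=
  compact [set: space O].

Definition omega_bounded (T : Type) (X : set T) (O : topology X) : Prop :=
  forall C : set (space O), countable C -> compact (closure C).

Section Join.
Context (T : Type) (X : set T) (O1 O2 : topology X).

Definition join_opens : set (set T) :=
  smallest (is_topology X) (opens O1 `|` opens O2).

Lemma join_is_topology : is_topology X join_opens.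
Proof.
split.
- move=> U /(_ [set V | V `<=` X]); apply; split.
    split => //=; first by move=> D DX x [V /DX]; apply.
    by move=> V W VX _ x [/VX].
  by move=> V [] /=; exact: top_sub (opensP _) _.
- by move=> P [tP _]; exact: top_full tP.
- move=> D DO P PO; have [tP _] := PO.
  by apply: top_bigcup tP _ _ => U /DO; apply.
- move=> U V OU OV P PO; have [tP _] := PO.
  by apply: topI tP _ _ (OU _ PO) (OV _ PO).
Qed.

Definition join : topology X := Topology join_is_topology.

End Join.

Notation softset A G := (A -> set G).

Definition soft_subset (A : Type) (G : groupType) (H K : softset A G) : Prop :=
  forall t, H t `<=` K t.

Record softGroup (A : Type) (G : groupType) := SoftGroup {
  sg_set :> softset A G;
  sg_group : forall t, group_closed (mem (sg_set t)) }.

Definition SE (A : Type) (G : groupType) (F : softset A G) : set (A -> G) :=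
  [set f | forall t, F t (f t)].

Record softTopology (A : Type) (G : groupType) (F : softset A G) :=
  SoftTopology {
  soft_opens : set (softset A G);
  soft_sub : forall H, soft_opens H -> soft_subset H F;
  soft_full : soft_opens F;
  soft_empty : soft_opens (fun=> set0);
  soft_bigcup : forall D : set (softset A G), D `<=` soft_opens ->
    soft_opens (fun t => \bigcup_(H in D) H t);
  softI : forall H K, soft_opens H -> soft_opens K ->
    soft_opens (fun t => H t `&` K t) }.

Section Component.
Context (A : Type) (G : groupType) (F : softset A G) (tau : softTopology F).
Context (t : A).

Definition component_opens : set (set G) :=
  [set H t | H in soft_opens tau].

Lemma component_is_topology : is_topology (F t) component_opens.
Proof.
split.
- by move=> _ [H tH <-]; exact: soft_sub tH t.
- by exists F => //; exact: soft_full.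
- move=> D DO; pose E := [set H | soft_opens tau H /\ D (H t)].
  exists (fun s => \bigcup_(H in E) H s).
    by apply: soft_bigcup => H [].
  apply/seteqP; split => x.
    by move=> [H [_ DH] Hx]; exists (H t).
  by move=> [U DU Ux]; have [H tH HU] := DO U DU; exists H; [split|]; rewrite ?HU.
- by move=> _ _ [H tH <-] [K tK <-]; exists (fun s => H s `&` K s) => //; exact: softI.
Qed.

Definition component : topology (F t) := Topology component_is_topology.

End Component.

Section Box.
Context (A : Type) (G : groupType) (F : softset A G).
Context (O : forall t, topology (F t)).

Definition box_base : set (set (A -> G)) :=
  [set SE U | U in [set U : softset A G | forall t, opens (O t) (U t)]].

Definition box_opens : set (set (A -> G)) :=
  [set W | exists2 D, D `<=` box_base & W = \bigcup_(B in D) B].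

Lemma box_is_topology : is_topology (SE F) box_opens.
Proof.
split.
- move=> _ [D DB ->] f [B /DB [U OU <-] Uf] t.
  by apply: top_sub (opensP (O t)) _ (OU t) _ (Uf t).
- exists [set SE F]; last by rewrite bigcup_set1.
  by move=> _ ->; exists F => // t; exact: top_full (opensP (O t)).
- move=> E EO; exists [set B | box_base B /\ exists2 W, E W & B `<=` W].
    by move=> B [].
  apply/seteqP; split => f.
    move=> [W EW Wf]; have [D DB WD] := EO W EW.
    move: Wf; rewrite WD => -[B DBB Bf]; exists B => //; split; first exact: DB.
    by exists W => //; rewrite WD; exact: bigcup_sup.
  by move=> [B [_ [W EW BW]] Bf]; exists W => //; exact: BW.
- move=> _ _ [D DB ->] [E EB ->].
  exists [set B | exists2 B1, D B1 & exists2 B2, E B2 & B = B1 `&` B2].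
    move=> _ [_ /DB[U OU <-] [_ /EB[V OV <-] ->]].
    exists (fun t => U t `&` V t).
      by move=> t; exact: topI (opensP (O t)) _ _ (OU t) (OV t).
    apply/seteqP; split => f; first by move=> h; split=> t; have [] := h t.
    by move=> [h1 h2] t; split; [exact: h1 | exact: h2].
  apply/seteqP; split => f.
    by move=> [[B1 D1 f1] [B2 E2 f2]]; exists (B1 `&` B2) => //; exists B1 => //; exists B2.
  by move=> [_ [B1 D1 [B2 E2 ->]] [f1 f2]]; split; [exists B1 | exists B2].
Qed.

Definition box : topology (SE F) := Topology box_is_topology.

End Box.

Definition selector (A : Type) (G : groupType) (F : softset A G)
  (tau : softTopology F) : topology (SE F) := box (component tau).

Section SoftGroup.
Context (A : Type) (G : groupType) (F : softGroup A G).

Lemma mulSE_subproof (a b : SE F) :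
  (fun t => \val a t * \val b t) \in SE F.
Proof.
apply/mem_set => t; apply/set_mem.
apply: (group_closedM (sg_group F t)); apply/mem_set.
  exact: (set_mem (valP a)) t.
exact: (set_mem (valP b)) t.
Qed.

Definition mulSE (a b : SE F) : SE F := 
  exist (fun f => f \in SE F) _ (mulSE_subproof a b).

Context (tau : softTopology F).

Definition soft_paratopological : Prop :=
  continuous (fun p : space (selector tau) * space (selector tau) =>
    mulSE p.1 p.2 : space (selector tau)).

Definition inv_set (U : set G) : set G := [set x^-1 | x in U].

Lemma inv_setE (U : set G) : inv_set U = [set x | U x^-1].
Proof.
apply/seteqP; split => x /=; first by move=> [y Uy <-]; rewrite invgK.
by move=> Ux; exists x^-1 => //; rewrite invgK.
Qed.

Definition conj_component_opens (t : A) : set (set G) :=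
  [set inv_set U | U in opens (component tau t)].

Lemma conj_component_is_topology (t : A) :
  is_topology (F t) (conj_component_opens t).
Proof.
have FV x : F t x -> F t x^-1.
  by move=> /mem_set Fx; apply/set_mem; exact: (group_closedV (sg_group F t)).
have tT := opensP (component tau t); split.
- move=> _ [U OU <-] _ [x Ux <-]; apply: FV.
  exact: top_sub tT _ OU _ Ux.
- exists (F t); first exact: top_full tT.
  rewrite inv_setE; apply/seteqP; split => x /= Fx; last exact: FV.
  by rewrite -(invgK x); exact: FV.
- move=> D DO; exists (\bigcup_(U in [set U | opens (component tau t) U /\ D (inv_set U)]) U).
    by apply: top_bigcup tT _ _ => U [].
  rewrite inv_setE; apply/seteqP; split => x.
    by move=> [U [_ DU] Ux]; exists (inv_set U) => //; rewrite inv_setE.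
  move=> [V DV Vx]; have [U OU UV] := DO V DV.
  by exists U; [split; rewrite ?UV | move: Vx; rewrite -UV inv_setE].
- move=> _ _ [U OU <-] [V OV <-]; exists (U `&` V); first exact: topI tT _ _ OU OV.
  by rewrite !inv_setE.
Qed.

Definition conj_component (t : A) : topology (F t) :=
  Topology (conj_component_is_topology t).

Definition conj_soft_opens : set (softset A G) :=
  [set H | soft_subset H F /\ forall t, opens (conj_component t) (H t)].

Lemma conj_soft_sub H : conj_soft_opens H -> soft_subset H F.
Proof. by case. Qed.

Lemma conj_soft_full : conj_soft_opens F.
Proof.
by split=> t; [exact: subset_refl | exact: top_full (conj_component_is_topology t)].
Qed.

Lemma conj_soft_bigcup (D : set (softset A G)) : D `<=` conj_soft_opens ->
  conj_soft_opens (fun t => \bigcup_(H in D) H t).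
Proof.
move=> DO; split=> t; first by move=> x [H /DO [HF _] Hx]; exact: HF Hx.
have -> : \bigcup_(H in D) H t = \bigcup_(U in [set H t | H in D]) U.
  by rewrite bigcup_image.
by apply: top_bigcup (conj_component_is_topology _) _ _ => _ [H /DO [_ HO] <-]; exact: HO.
Qed.

Lemma conj_soft_empty : conj_soft_opens (fun=> set0).
Proof.
split=> [t x //|t].
have := @top_bigcup _ _ _ (opensP (conj_component t)) set0 (@sub0set _ _).
by rewrite bigcup_set0.
Qed.

Lemma conj_softI H K : conj_soft_opens H -> conj_soft_opens K ->
  conj_soft_opens (fun t => H t `&` K t).
Proof.
move=> [HF HO] [_ KO]; split=> t; first by move=> x [/HF].
exact: topI (conj_component_is_topology _) _ _ (HO t) (KO t).
Qed.

Definition conj_soft : softTopology F :=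
  SoftTopology conj_soft_sub conj_soft_full conj_soft_empty conj_soft_bigcup
    conj_softI.

(* Hence the products of members of the inverted component topologies form a
   base of selector conj_soft. *)
Lemma component_conj_soft (t : A) :
  opens (component conj_soft t) = opens (conj_component t).
Proof.
apply/seteqP; split => U; first by move=> [H [_ HO] <-]; exact: HO.
move=> OU; exists (fun s => [set x | F s x /\ (s = t -> U x)]).
  split=> s; first by move=> x [].
  have [->|st] := pselect (s = t).
    rewrite (_ : [set x | _] = U) //; apply/seteqP; split => x /=.
      by move=> [_]; exact.
    by move=> Ux; split => //; exact: top_sub (conj_component_is_topology _) _ OU _ Ux.
  rewrite (_ : [set x | _] = F s); first exact: top_full (conj_component_is_topology _).
  by apply/seteqP; split => x //= [].
apply/seteqP; split => x /=; first by move=> [_]; exact.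
by move=> Ux; split => //; exact: top_sub (conj_component_is_topology _) _ OU _ Ux.
Qed.

Definition component_join (t : A) : topology (F t) :=
  join (component tau t) (conj_component t).

Definition selector_join : topology (SE F) :=
  join (selector tau) (selector conj_soft).

End SoftGroup.

(* Main.v *)
Require Import Defs.
From mathcomp Require Import all_boot perm.
From mathcomp Require Import boolp classical_sets functions cardinality topology.

Set Implicit Arguments.
Unset Strict Implicit.
Unset Printing Implicit Defensive.

Local Open Scope classical_set_scope.

(** Every point of a member of a binary join has a neighbourhood [U `&` V] with
    [U] and [V] open for the two topologies, and a product of such
    intersections is the intersection of two boxes: this identifies the join of
    the box topologies.  For a finite parameter set, an ultrafilter whose
    coordinate images cluster coordinatewise converges in the box topology, as
    only finitely many coordinate conditions have to be met.  For an infinite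
    parameter set, the discrete soft topology on a constant finite nontrivial
    group has finite components, whereas its selector space is discrete and
    infinite. *)

(** * Joins of topologies and of box topologies *)

Lemma opens_inj (T : Type) (X : set T) : injective (@opens T X).
Proof.
by move=> [O1 P1] [O2 P2] /= E; move: P1 P2; rewrite E => P1 P2; congr Topology.
Qed.

Lemma open_spaceP (T : Type) (X : set T) (O : topology X) (W : set (space O)) :
  open W <-> exists2 U, opens O U & W = (fun x : space O => U (\val x)).
Proof. by split=> -[U OU UW]; exists U. Qed.

Lemma top_local (T : Type) (X : set T) (O : set (set T)) (W : set T) :
  is_topology X O ->
  (forall x, W x -> exists U, [/\ O U, U x & U `<=` W]) -> O W.
Proof.
move=> tO WO; have -> : W = \bigcup_(U in [set U | O U /\ U `<=` W]) U.
  apply/seteqP; split => x; first by move=> /WO[U [OU Ux UW]]; exists U.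
  by move=> [U [_ UW] Ux]; exact: UW.
by apply: top_bigcup tO _ _ => U [].
Qed.

(** The sets satisfying the right-hand condition form a topology that contains both families, so
    they include the smallest such topology. Conversely, such a set is a union of intersections [U]
    [&] [V], each of which is open in the join. *)
Lemma join_opensP (T : Type) (X : set T) (O1 O2 : topology X) (W : set T) :
  opens (join O1 O2) W <->
  forall x, W x -> exists U V,
    [/\ opens O1 U, opens O2 V, U x, V x & U `&` V `<=` W].
Proof.
have T1 := opensP O1; have T2 := opensP O2.
split=> [|WO].
  pose P : set (set T) := [set W | forall x, W x -> exists U V,
    [/\ opens O1 U, opens O2 V, U x, V x & U `&` V `<=` W]].
  move=> WJ; suff : P W by [].
  apply: WJ; split; last first.
    move=> U [OU|OU] x Ux; [exists U, X|exists X, U].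
      by split => //; [exact: top_full T2|exact: top_sub T1 _ OU _ Ux].
    by split => //; [exact: top_full T1|exact: top_sub T2 _ OU _ Ux].
  split.
  - move=> U PU x /PU[V [V' [OV OV' Vx V'x VV']]].
    exact: top_sub T1 _ OV _ Vx.
  - by move=> x Xx; exists X, X; split=> //; [exact: top_full T1|exact: top_full T2].
  - move=> D DP x [U DU Ux]; have [V [V' [OV OV' Vx V'x VV']]] := DP U DU x Ux.
    by exists V, V'; split=> // y /VV' Uy; exists U.
  - move=> U U' PU PU' x [/PU[V [V' [OV OV' Vx V'x VV']]] /PU'[Z [Z' [OZ OZ' Zx Z'x ZZ']]]].
    exists (V `&` Z), (V' `&` Z'); split=> //; [exact: topI T1 _ _ OV OZ|exact: topI T2 _ _ OV' OZ'|].
    by move=> y [[Vy Zy] [V'y Z'y]]; split; [exact: VV'|exact: ZZ'].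
apply: (top_local (opensP (join O1 O2))) => x /WO[U [V [OU OV Ux Vx UVW]]].
exists (U `&` V); split => //; apply: (topI (opensP (join O1 O2))) => Q [_].
  by apply; left.
by apply; right.
Qed.

Lemma join_selector (A : Type) (G : groupType) (F : softGroup A G)
    (tau : softTopology F) :
  opens (selector_join tau) = opens (box (component_join tau)).
Proof.
apply/seteqP; split => W.
  (* Minimality of the join: the box topology of the component joins contains both selector
     topologies, since each component join contains both component topologies. *)
  apply; split; first exact: opensP.
  move=> _ [] [D DB ->]; exists D => // B /DB[U OU <-]; exists U => // t Q [_];
    apply; [left|right]; first exact: OU.
  by have := OU t; rewrite component_conj_soft.
move=> [D DB ->]; apply/join_opensP => f [B DBB Bf].
have [U OU UB] := DB B DBB.
(* Choosing a pair of neighbourhoods in every coordinate at once gives two boxes, one for each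
   selector topology, that meet inside [B]. *)
have /choice[p pP] : forall t, exists p : set G * set G,
    [/\ opens (component tau t) p.1, opens (conj_component tau t) p.2,
        p.1 (f t), p.2 (f t) & p.1 `&` p.2 `<=` U t].
  move=> t; have := OU t => /join_opensP/(_ (f t)); rewrite -UB in Bf.
  by case=> [|V [V' ?]]; [exact: Bf|exists (V, V')].
have boxW (O : forall t, topology (F t)) (V : softset A G) :
    (forall t, opens (O t) (V t)) -> opens (box O) (SE V).
  move=> OV; exists [set SE V]; last by rewrite bigcup_set1.
  by move=> _ ->; exists V.
exists (SE (fun t => (p t).1)), (SE (fun t => (p t).2)); split.
- by apply: boxW => t; have [] := pP t.
- by apply: boxW => t; rewrite component_conj_soft; have [] := pP t.
- by move=> t; have [] := pP t.
- by move=> t; have [] := pP t.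
- move=> g [g1 g2]; exists B => //; rewrite -UB => t.
  by have [_ _ _ _] := pP t; apply; split; [exact: g1|exact: g2].
Qed.

(** * Boxes over a finite parameter set *)

Lemma filter_forall_finite (I T : Type) (P : set_system T) (f : I -> set T) :
  finite_set [set: I] -> Filter P -> (forall i, P (f i)) ->
  P [set x | forall i, f i x].
Proof.
(* [{classic I}] equips the bare type [I] with the choice structure needed to enumerate it as a
   finite set. *)
move=> /(@finite_fsetP {classic I})[X XE] PF Pf.
apply: filterS (@filter_bigI T {classic I} X f P PF (fun i _ => Pf i)) => x /= h i.
by apply: h; rewrite -XE.
Qed.

Section FiniteBox.
Context (A : Type) (G : groupType) (F : softset A G).
Context (O : forall t, topology (F t)).

Definition box_proj (t : A) (x : space (box O)) : space (O t) :=
  exist (fun y => y \in F t) (\val x t) (mem_set (set_mem (valP x) t)).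

Lemma box_proj_continuous (t : A) : continuous (box_proj t).
Proof.
apply/continuousP => _ /open_spaceP[U OU ->]; apply/open_spaceP.
(* The box with side [U] at [t] and side [F s] elsewhere; the implication spares a decision of
   [s = t] inside the definition. *)
exists (SE (fun s => [set x | F s x /\ (s = t -> U x)])).
  eexists [set _]; last by rewrite bigcup_set1.
  move=> _ ->; eexists => // s /=.
  have [->|st] := pselect (s = t).
    rewrite (_ : [set x | _] = U) //; apply/seteqP; split => x /=.
      by move=> [_]; exact.
    by move=> Ux; split => //; exact: top_sub (opensP _) _ OU _ Ux.
  rewrite (_ : [set x | _] = F s); first exact: top_full (opensP _).
  by apply/seteqP; split => x //= [].
apply/seteqP; split => x /=; last by move=> /(_ t)[_]; exact.
by move=> Ux s; split => [|->//]; exact: set_mem (valP x) s.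
Qed.

Lemma omega_bounded_box : finite_set [set: A] ->
  (forall t, omega_bounded (O t)) -> omega_bounded (box O).
Proof.
move=> finA bO C cC; rewrite compact_ultra => P PU PC.
have PF : ProperFilter P by exact: ultra_proper.
have lim t : exists x : space (O t), forall V : set (space (O t)), nbhs x V -> P (box_proj t @^-1` V).
  have cK := bO t (box_proj t @` C) (card_le_trans (card_image_le _ _) cC).
  have PK : P (box_proj t @^-1` closure (box_proj t @` C)).
    apply: filterS PC => x Cx V xV; have Vx := box_proj_continuous xV.
    by have [y [Cy Vy]] := Cx _ Vx; exists (box_proj t y); split => //; exists y.
  have [x [_ clx]] := cK _ (fmap_proper_filter (box_proj t) PF) PK; exists x => V xV.
  have [//|PnV] := in_ultra_setVsetC (box_proj t @^-1` V) PU.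
  by have [y [nVy Vy]] := clx (~` V) V PnV xV.
have /choice [x xP] : forall t, exists x : G, F t x /\
    forall U, opens (O t) U -> U x -> P [set f | U (\val f t)].
  move=> t; have [x xP] := lim t; exists (\val x).
  split=> [|U OU Ux]; first exact: set_mem (valP x).
  apply: (xP (fun y => U (\val y))); apply: open_nbhs_nbhs; split => //.
  by apply/open_spaceP; exists U.
pose x0 : space (box O) :=
  exist (fun y => y \in SE F) x (mem_set (fun t => (xP t).1)).
have Px0 : P --> x0.
  move=> W; rewrite nbhsE => -[W' [/open_spaceP[_ [D DB ->] W'E] W'x] /filterS].
  apply; move: W'x; rewrite W'E => -[B DBB Bx].
  have [U OU UB] := DB B DBB; rewrite -UB in Bx.
  apply: filterS (filter_forall_finite finA PF
    (fun t => (xP t).2 _ (OU t) (Bx t))) => f Uf.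
  by exists B => //; rewrite -UB.
(* The limit stays in [closure C], a closed set belonging to [P]. *)
exists x0; split => //; apply: (closed_cvg (fun y => closure C y)) Px0 => //.
exact: closed_closure.
Qed.

End FiniteBox.

(** * The discrete example over an infinite parameter set *)

Lemma discrete_range_not_compact (T : topologicalType) (f : nat -> T) :
  (forall x : T, open [set x]) -> injective f -> ~ compact (range f).
Proof.
(* The filter of images of tails does not cluster in the range: [f N] is isolated and, by
   injectivity, is missed by the indices beyond [N]. *)
move=> dT fI /(_ (f @ \oo) _)[|_ [[N _ <-] clN]].
  by exists 0%N => // n _; exists n.
have [||_ [[n Nn <-] /fI nN]] := clN (f @` [set n | (N < n)%N]) [set f N].
- by exists N.+1 => // n Nn; exists n.
- by apply: open_nbhs_nbhs.
- by move: Nn; rewrite nN /= ltnn.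
Qed.

Lemma compact_omega_bounded (T : Type) (X : set T) (O : topology X) :
  compact_top O -> omega_bounded O.
Proof.
by move=> cO C _; apply: subclosed_compact cO _ => //; exact: closed_closure.
Qed.

Lemma finite_compact_top (T : finType) (X : set T) (O : topology X) :
  compact_top O.
Proof.
apply: finite_compact; rewrite -(preimage_setT (\val : space O -> T)).
by apply: finite_preimage => // x y _ _; exact: val_inj.
Qed.

Section Discrete.
Context (A : Type) (G : groupType).

Lemma full_group_closed (t : A) : group_closed (mem [set: G]).
Proof. by split=> [|x y _ _]; rewrite inE. Qed.

Definition full_soft : softGroup A G := SoftGroup full_group_closed.

(** Kept transparent so that [soft_opens] unfolds to [setT]. *)
Definition discrete_soft : softTopology full_soft.
Proof. by exists setT. Defined.

Lemma open_discrete_selector (W : set (A -> G)) :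
  opens (selector discrete_soft) W.
Proof.
(* Each singleton is itself a box, with singleton sides. *)
exists [set [set f] | f in W]; last by rewrite bigcup_image bigcup_imset1 image_id.
move=> _ [f Wf <-]; exists (fun t => [set f t]).
  by move=> t; exists (fun s => [set f s]).
by apply/seteqP; split=> g => [h|->//]; apply/funext => t; exact: h.
Qed.

Lemma discrete_soft_paratopological : soft_paratopological discrete_soft.
Proof.
have sgl (x : space (selector discrete_soft)) : nbhs x [set x].
  apply: open_nbhs_nbhs; split=> //; apply/open_spaceP.
  exists [set \val x]; first exact: open_discrete_selector.
  by apply/seteqP; split=> y => [->//|/val_inj].
move=> [a b] W /nbhs_singleton Wab; exists ([set a], [set b]); first by split; apply: sgl.
by move=> [a' b'] [/= -> ->].
Qed.

Lemma discrete_join_not_omega_bounded (g : G) :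
  infinite_set [set: A] -> g != 1%g ->
  ~ omega_bounded (selector_join discrete_soft).
Proof.
move=> infA g1; have [e eI] : exists e : nat -> A, injective e.
  have /infiniteP/card_leP[h] := infA.
  exists (fun n => \val (h (SigSub (mem_set (I : [set: nat] n))))) => m n /val_inj.
  by move=> /(@inj _ _ _ h); rewrite !inE => /(_ I I)[].
(* The selector [d n] differs from the identity only at [e n], so [g != 1] makes these countably
   many points distinct. Their range is closed, the join being discrete. *)
pose d n : space (selector_join discrete_soft) := exist (fun f => f \in SE full_soft)
  (fun t => if `[< t = e n >] then g else 1%g) (mem_set (fun=> I)).
have dI : injective d.
  move=> m n /(congr1 (fun f => \val f (e m))) /=.
  by rewrite asboolT //; case: asboolP => [/eI//|_ /eqP]; rewrite (negPf g1).
have od (W : set (space (selector_join discrete_soft))) : open W.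
  apply/open_spaceP; exists (\val @` W).
    by move=> Q [_]; apply; left; exact: open_discrete_selector.
  by apply/seteqP; split => x => [Wx|[y Wy /val_inj<-//]]; exists x.
move=> /(_ (range d) (card_image_le _ _)); rewrite -(closure_id _).1.
  by apply: discrete_range_not_compact.
by rewrite -openC; exact: od.
Qed.

End Discrete.

Theorem proposition4p10 (A : Type) (A_neq0 : [set: A] !=set0) :
  (forall (G : groupType) (F : softGroup A G) (tau : softTopology F),
     soft_paratopological tau ->
     opens (selector_join tau) = opens (box (component_join tau)) /\
     (finite_set [set: A] ->
      (forall t : A, omega_bounded (component_join tau t)) ->
      omega_bounded (selector_join tau))) /\
  (infinite_set [set: A] ->
     (exists (G : groupType) (F : softGroup A G) (tau : softTopology F),
        [/\ soft_paratopological tau,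
            forall t : A, compact_top (component_join tau t) &
            ~ compact_top (selector_join tau)]) /\
     (exists (G : groupType) (F : softGroup A G) (tau : softTopology F),
        [/\ soft_paratopological tau,
            forall t : A, omega_bounded (component_join tau t) &
            ~ omega_bounded (selector_join tau)])).
Proof.
split=> [G F tau _|infA].
  split=> [|finA bO]; first exact: join_selector.
  (* Equal families of open sets give equal topologies by proof irrelevance, so the bound transfers
     from the box of the joins. *)
  by rewrite (opens_inj (join_selector tau)); exact: omega_bounded_box.
have swap1 : tperm false true != 1%g.
  by apply/eqP => /permP/(_ false); rewrite tpermL perm1.
have nb := discrete_join_not_omega_bounded infA swap1.
have cj t : compact_top (component_join (discrete_soft A {perm bool}) t).
  exact: (@finite_compact_top {perm bool}).
(* One example serves both claims, because compactness implies [omega_bounded]: the components are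
   compact, and the selector join is not even [omega_bounded]. *)
split; exists {perm bool}, (full_soft A {perm bool}), (discrete_soft A {perm bool}).
  split=> //; first exact: discrete_soft_paratopological.
  by move=> /compact_omega_bounded.
split=> //; first exact: discrete_soft_paratopological.
by move=> t; apply: compact_omega_bounded.
Qed.
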